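(* Let $\alpha \leq \kappa(\mathfrak{Small})$ be a regular cardinal and let $\mathfrak{J}_\alpha$ be a set of $\alpha$-small sets containing all $\alpha$-small cardinals. Let $G$ be a set of $\mathfrak{J}_\alpha$-ary operations on a small set $A$, and let $f:A^J \rightarrow A$ be an operation with $J \in \mathfrak{J}_\alpha$. The following are equivalent: (1) $f \in G^\perp$, i.e. $f$ is an element of the $\mathfrak{J}_\alpha$-ary centralizer clone of $G$; (2) $h(f) = f(h \circ u_J)$ for every operation $h:A^{(A^J)} \rightarrow A$ of arity $A^J$ in the $\mathfrak{Small}$-ary clone $\langle G\rangle$ generated by $G$, where $u_J:J \rightarrow A^{(A^J)}$ is the map that sends each $j \in J$ to the projection $\pi_j:A^J \rightarrow A$; (3) $f$ commutes with every operation $h:A^{(A^J)} \rightarrow A$ of arity $A^J$ in $\langle G\rangle$.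
   Context: Fix a Grothendieck universe $\mathfrak{Small}$, i.e. the set of all sets of rank less than a fixed inaccessible cardinal $\kappa = \kappa(\mathfrak{Small})$; its elements are called small sets. Let $\alpha \leq \kappa(\mathfrak{Small})$ be an (infinite) regular cardinal. A set is $\alpha$-small if it is small and has cardinality less than $\alpha$. Fix a set $\mathfrak{J}_\alpha$ of sets with $\mathfrak{Card}_\alpha \subseteq \mathfrak{J}_\alpha \subseteq \mathfrak{Small}_\alpha$, where $\mathfrak{Card}_\alpha$ is the set of all $\alpha$-small cardinals and $\mathfrak{Small}_\alpha$ is the set of all $\alpha$-small sets. Given a set $A$, an operation on $A$ of arity $J$ is a map $A^J \to A$, where $J$ is a set; it is $\mathfrak{J}_\alpha$-ary if $J \in \mathfrak{J}_\alpha$, and $\mathfrak{Small}$-ary if $J$ is a small set (the latter is the case $\alpha=\kappa(\mathfrak{Small})$, $\mathfrak{J}_\alpha=\mathfrak{Small}$). Nullary operations ($J=\emptyset$) are allowed. A set of $\mathfrak{J}_\alpha$-ary operations on $A$ is a subset of the disjoint union $\coprod_{J \in \mathfrak{J}_\alpha} A^{(A^J)}$ of all $\mathfrak{J}_\alpha$-ary operations. A $\mathfrak{Small}$-ary clone on $A$ is a set $F$ of $\mathfrak{Small}$-ary operations on $A$ that contains all projections $\pi_x:A^X\to A$ ($X$ small, $x\in X$) and is such that for all small $X,Y$, every $f:A^Y\to A$ in $F$ and every family $g_y:A^X\to A$ $(y\in Y)$ in $F$, the composite $f\circ(g_y)_{y\in Y}:A^X\to A$ lies in $F$. Any set $G$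 of $\mathfrak{J}_\alpha$-ary operations is also a set of $\mathfrak{Small}$-ary operations, and $\langle G\rangle$ denotes the smallest $\mathfrak{Small}$-ary clone on $A$ containing $G$. Operations $f:A^X\to A$ and $g:A^Y\to A$ commute, written $f\perp g$, if for every matrix $a=(a_{xy})\in A^{X\times Y}$ one has $g\bigl((f((a_{xy})_{x\in X}))_{y\in Y}\bigr)=f\bigl((g((a_{xy})_{y\in Y}))_{x\in X}\bigr)$. The $\mathfrak{J}_\alpha$-ary centralizer (clone) $G^\perp$ of $G$ is the set of all $\mathfrak{J}_\alpha$-ary operations $f$ on $A$ with $f\perp g$ for all $g\in G$. In $h(f)$, the map $f:A^J\to A$ is regarded as an element of $A^{(A^J)}$; and $h\circ u_J: J\to A$ is regarded as an element of $A^J$. *)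

(* Defs.v *)
From mathcomp Require Import all_boot.
From mathcomp Require Import boolp classical_sets functions cardinality.

Set Implicit Arguments.
Unset Strict Implicit.
Unset Printing Implicit Defensive.

Local Open Scope classical_set_scope.
Local Open Scope card_scope.

(* The Grothendieck universe is a fixed type universe; [Large] is a universe
   above it, which provides carriers for cardinals that need not be small
   (the cardinal kappa of the universe itself, in particular). *)
Definition Large := Type.
Definition Small : Large := Type.

Definition card_lt T U (A : set T) (B : set U) := (A #<= B) && (A #!= B).
Notation "A '#<' B" := (card_lt A B) (at level 79) : card_scope.

(* A cardinal is given by a carrier type and is only used through the relations
   [#<=], [#=] and [#<]. Regularity: an infinite cardinal alpha is regular iff a
   set of cardinality alpha is not the union of fewer than alpha sets, each of
   cardinality less than alpha. *)
Definition regular_cardinal (alpha : Large) :=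
  infinite_set [set: alpha] /\
  forall (I : set alpha) (F : alpha -> set alpha),
    I #< [set: alpha] -> (forall i, I i -> F i #< [set: alpha]) ->
    \bigcup_(i in I) F i <> [set: alpha].

(* alpha <= kappa: every cardinal below alpha is below kappa, and the cardinals
   below kappa are exactly the cardinalities of small sets. *)
Definition le_kappa (alpha : Large) :=
  forall B : set alpha, B #< [set: alpha] ->
    exists X : Small, B #= [set: X].

Definition alpha_small (alpha : Large) : set Small :=
  [set X : Small | [set: X] #< [set: alpha]].

(* Type theory has no von Neumann cardinals; the (small) cardinals are any class
   of small types that contains exactly one type of each cardinality. *)
Definition cardinal_system (Card : set Small) :=
  forall X : Small, exists! C : Small, Card C /\ [set: X] #= [set: C].

Definition operation (A X : Small) : Small := (X -> A) -> A.

(* A subset of the disjoint union of the sets of X-ary operations, X small. *)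
Definition op_set (A : Small) := forall X : Small, set (operation A X).

Definition op_subset (A : Small) (F G : op_set A) :=
  forall X : Small, F X `<=` G X.

Definition ary (JJ : set Small) (A : Small) (G : op_set A) :=
  forall (X : Small) (g : operation A X), G X g -> JJ X.

Definition proj (A X : Small) (x : X) : operation A X := fun a => a x.

Definition compose (A X Y : Small) (f : operation A Y)
  (g : Y -> operation A X) : operation A X := fun a => f (fun y => g y a).

Definition clone (A : Small) (F : op_set A) :=
  (forall (X : Small) (x : X), F X (proj x)) /\
  (forall (X Y : Small) (f : operation A Y) (g : Y -> operation A X),
     F Y f -> (forall y, F X (g y)) -> F X (compose f g)).

Definition clone_gen (A : Small) (G : op_set A) : op_set A :=
  fun X f => forall F : op_set A, clone F -> op_subset G F -> F X f.

Lemma clone_gen_clone (A : Small) (G : op_set A) : clone (clone_gen G).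
Proof.
split=> [X x F [Fp _] _|X Y f g Gf Gg F cF GF]; first exact: Fp.
by case: (cF) => _; apply=> [|y]; [exact: Gf|exact: Gg].
Qed.

Lemma sub_clone_gen (A : Small) (G : op_set A) : op_subset G (clone_gen G).
Proof. by move=> X g Gg F _; apply. Qed.

Lemma clone_gen_min (A : Small) (G F : op_set A) :
  clone F -> op_subset G F -> op_subset (clone_gen G) F.
Proof. by move=> cF GF X f; apply. Qed.

Definition commutes (A X Y : Small) (f : operation A X) (g : operation A Y) :=
  forall a : X -> Y -> A,
    g (fun y => f (fun x => a x y)) = f (fun x => g (fun y => a x y)).

Definition centralizer (JJ : set Small) (A : Small) (G : op_set A) : op_set A :=
  fun X f => JJ X /\ forall (Y : Small) (g : operation A Y), G Y g -> commutes f g.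

Arguments clone_gen {A} G X _.
Arguments centralizer JJ {A} G X _.
Arguments proj A {X} x _.

(* Main.v *)
(* Evaluating [h] at [f] is commutation of [f] with [h] on the tautological
   matrix [J * A^J -> A], [(j, x) |-> x j]. Every matrix is a pullback of this
   one: the matrix [a] of size [J * Y] together with [g] of arity [Y] gives the
   composite of [g] with the projections at the columns of [a], an operation of
   arity [A^J] that lies in every clone containing [g]. *)
Require Import Defs.
From mathcomp Require Import all_boot.
From mathcomp Require Import boolp classical_sets functions cardinality.

Local Open Scope classical_set_scope.

(** By minimality of [clone_gen G], commutation with the generators then extends to every operation
    they generate, of any small arity. *)
Lemma clone_commutes (A J : Small) (f : operation A J) :
  clone (fun (X : Small) (g : operation A X) => commutes f g).
Proof.
split=> [X x a //|X Y g k fg fk a]; rewrite /compose -fg.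
by congr g; apply: funext => y; apply: fk.
Qed.

Lemma clone_eval_commutes (A : Small) (F : op_set A) (J : Small)
    (f : operation A J) :
  clone F ->
  (forall h : operation A (J -> A), F (J -> A) h ->
     h f = f (h \o (fun j : J => proj A j))) ->
  forall (Y : Small) (g : operation A Y), F Y g -> commutes f g.
Proof.
move=> [Fproj Fcomp] evalF Y g Fg a.
(* For this composite, the two sides of [evalF] reduce by computation to the two sides of
   [commutes f g] at [a]. *)
apply: (evalF (compose g (fun y => proj A (fun x => a x y)))).
by apply: Fcomp => // y; apply: Fproj.
Qed.

Theorem theorem5p3 (Card : set Small) (hCard : cardinal_system Card)
  (alpha : Large) (hreg : regular_cardinal alpha) (hkappa : le_kappa alpha)
  (JJ : set Small) (hCardJ : Card `&` alpha_small alpha `<=` JJ)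
  (hJsmall : JJ `<=` alpha_small alpha)
  (A : Small) (G : op_set A) (hG : ary JJ G)
  (J : Small) (hJ : JJ J) (f : operation A J) :
  [<-> centralizer JJ G J f;
       forall h : operation A (J -> A), clone_gen G (J -> A) h ->
         h f = f (h \o (fun j : J => proj A j));
       forall h : operation A (J -> A), clone_gen G (J -> A) h ->
         commutes f h].
Proof.
tfae=> [[_ fG] h Gh|evalG h|fG].
- have fh : commutes f h := clone_gen_min (clone_commutes _ _ f) fG Gh.
  exact: (fh (fun j x => x j)).
- exact: clone_eval_commutes _ _ _ _ (clone_gen_clone G) evalG _ h.
- split=> // Y g Gg.
  (* [fG] only covers arity [J -> A], while the generator [g] has its own arity [Y]; the evaluation
     identity bridges the two. *)
  apply: (clone_eval_commutes _ _ _ _ (clone_gen_clone G) _ _ _ (sub_clone_gen Gg)).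
  by move=> h Gh; apply: (fG h Gh (fun j x => x j)).
Qed.
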